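(* Let $D$ be a digraph of order $n$ with $D\in\mathcal{L}$ and $\ell_s(D)>0$. (a) If $D$ is an oriented graph with minimum in-degree at least $2$, then $\ell_s(D)\ge (n/2)^{1/5}-1$. (b) If $D$ has minimum in-degree at least $3$, then $\ell_s(D)\ge (n/2)^{1/5}-1$.
   Context: Digraphs are finite, without loops or parallel arcs (directed 2-cycles are allowed); an oriented graph is a digraph with no directed 2-cycle. An out-tree of a digraph $D$ is a subdigraph $T$ that is an oriented tree with exactly one vertex of in-degree zero (the root); its leaves are its vertices of out-degree zero. An out-branching of $D$ is an out-tree $T$ with $V(T)=V(D)$. $\ell(D)$ denotes the maximum number of leaves of an out-tree of $D$, and $\ell_s(D)$ the maximum number of leaves of an out-branching of $D$, with $\ell_s(D)=0$ if $D$ has no out-branching. $\mathcal{L}$ is the family of digraphs $D$ for which either $\ell_s(D)=0$ or $\ell_s(D)=\ell(D)$. *)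

(* Defs.v *)
From HB Require Import structures.
From mathcomp Require Import all_boot all_order all_algebra.
From mathcomp Require Import reals exp.

Set Implicit Arguments.
Unset Strict Implicit.
Unset Printing Implicit Defensive.

(* The arcs form a relation, so there are no parallel arcs, but directed
   2-cycles are possible. *)
Record digraph := Digraph {
  vertex :> finType;
  arc : rel vertex;
  arc_irrefl : irreflexive arc
}.

Definition oriented (D : digraph) : Prop :=
  forall x y : D, arc x y -> ~~ arc y x.

Definition indegree (D : digraph) (x : D) : nat := #|[set y : D | arc y x]|.

Definition min_indegree_ge (D : digraph) (k : nat) : Prop :=
  forall x : D, k <= indegree x.

Section Subdigraphs.

Variable D : digraph.

(* A candidate subdigraph is a vertex set with an arc set. *)
Definition subdigraph := ({set D} * {set D * D})%type.

Implicit Types H : subdigraph.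

Definition is_subdigraph H : bool :=
  [forall a in H.2, [&& a.1 \in H.1, a.2 \in H.1 & arc a.1 a.2]].

Definition sub_indegree H (x : D) : nat := #|[set y | (y, x) \in H.2]|.

Definition sub_outdegree H (x : D) : nat := #|[set y | (x, y) \in H.2]|.

Definition sub_oriented H : bool :=
  [forall x, forall y, ((x, y) \in H.2) ==> ((y, x) \notin H.2)].

Definition adjacent H : rel D :=
  [rel x y | ((x, y) \in H.2) || ((y, x) \in H.2)].

(* For a subdigraph H, paths starting in H.1 stay in H.1. *)
Definition connected H : bool :=
  [forall x in H.1, forall y in H.1, connect (adjacent H) x y].

(* A cycle of the underlying graph has at least 3 distinct vertices, hence the
   finite bounds on its length; acyclicP gives the unbounded form. *)
Definition acyclic H : bool :=
  [forall k : 'I_#|D|.+1, (2 < k) ==>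
    [forall p : k.-tuple D, ~~ ucycleb (adjacent H) p]].

Lemma acyclicP H :
  reflect (forall p : seq D, ucycle (adjacent H) p -> size p <= 2) (acyclic H).
Proof.
apply: (iffP forallP) => [acH p ucp | acH k].
  rewrite leqNgt; apply/negP => lt2p.
  have lepD : size p < #|D|.+1.
    by rewrite ltnS -(card_uniqP (proj2 (andP ucp))) max_card.
  have /implyP/(_ lt2p)/forallP/(_ (in_tuple p)) := acH (Ordinal lepD).
  by rewrite /= (ucp : is_true (ucycleb _ _)).
apply/implyP => lt2k; apply/forallP => p; apply/negP => ucp.
by have := acH p ucp; rewrite size_tuple leqNgt lt2k.
Qed.

(* Connectedness here allows H.1 to be empty; the unique root in out_tree
   excludes that case. *)
Definition oriented_tree H : bool :=
  [&& is_subdigraph H, sub_oriented H, connected H & acyclic H].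

Definition root_set H : {set D} := [set x in H.1 | sub_indegree H x == 0].

Definition leaves H : {set D} := [set x in H.1 | sub_outdegree H x == 0].

Definition out_tree H : bool := oriented_tree H && (#|root_set H| == 1).

Definition out_branching H : bool := out_tree H && (H.1 == [set: D]).

Definition max_leaves : nat := \max_(H : subdigraph | out_tree H) #|leaves H|.

(* The maximum over an empty range is 0, as required when D has no
   out-branching. *)
Definition max_leaves_spanning : nat :=
  \max_(H : subdigraph | out_branching H) #|leaves H|.

Definition family_L : Prop :=
  max_leaves_spanning = 0 \/ max_leaves_spanning = max_leaves.

End Subdigraphs.

(* Main.v *)
Require Import Defs.
From HB Require Import structures.
From mathcomp Require Import all_boot all_order all_algebra.
From mathcomp Require Import reals exp.
From mathcomp Require Import zify.

(** Write [k] for the maximum number of leaves of an out-tree, and fix an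
    out-branching [T] of [D], given by a parent function [p]. Call a vertex
    backless if no in-neighbour is a descendant of it in [T] at distance at
    least 2. Sending every other vertex [x] to such an in-neighbour [beta x]
    gives a forest of out-trees of [D] rooted at the backless vertices. Each has
    at most [k] leaves, and each of its root paths has at most [k + 1] vertices,
    because to the path one can attach, for every non-root [x] on it, the child
    of [x] in [T] towards [beta x]. Hence [n <= k (k + 1) * #|backless|].

    A root-to-leaf path of [T] has at most [k] children hanging off it. A
    backless vertex on the path away from those has, by the degree assumption,
    an in-neighbour that is neither its parent nor a descendant; rerouting half
    of these vertices at once to such in-neighbours makes their old parents
    leaves, so there are at most [2k] of them. Summing over the at most [k]
    root-to-leaf paths, [#|backless| <= k (4k + 1)]. *)

Set Implicit Arguments.
Unset Strict Implicit.
Unset Printing Implicit Defensive.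

Import Order.TTheory GRing.Theory Num.Theory.

(* path.v also defines an [arc]. *)
Local Notation arc := (@Defs.arc _).

(** * Covers, two-colourings and iterates on finite sets *)

Section FiniteSets.

Variable T : finType.

Lemma card_cover_le (I : finType) (S : {set T}) (L : {set I})
    (A : I -> {set T}) m :
  (forall x, x \in S -> exists2 l, l \in L & x \in A l) ->
  (forall l, l \in L -> #|A l| <= m) -> #|S| <= #|L| * m.
Proof.
move=> cov cardA.
have sSA : S \subset \bigcup_(l in L) A l.
  by apply/subsetP => x /cov[l lL xA]; apply/bigcupP; exists l.
apply: leq_trans (subset_leq_card sSA) _.
apply: (@leq_trans (\sum_(l in L) #|A l|)).
  elim/big_rec2: _ => [|l s B _ IH]; first by rewrite cards0.
  by rewrite cardsU; lia.
by rewrite -sum_nat_const leq_sum.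
Qed.

(** Induction, removing a vertex [z] of largest [h]: no vertex of [F] is related by [e] to [z], and
    [z] is related to at most one vertex of the rest, whose colour it avoids. *)
Lemma bicoloring (e : rel T) (h : T -> nat) (F : {set T}) :
  (forall x y, x \in F -> y \in F -> e y x -> h x < h y) ->
  (forall x x' y, x \in F -> x' \in F -> y \in F -> e y x -> e y x' -> x = x') ->
  exists c : T -> bool,
    forall x y, x \in F -> y \in F -> e y x -> c x != c y.
Proof.
move: {2}#|F| (leqnn #|F|) => n; elim: n F => [|n IH] F leFn eh eU.
  exists xpredT => x y xF; move: leFn; rewrite leqn0 cards_eq0 => /eqP F0.
  by rewrite F0 inE in xF.
have [F0|[z0 z0F]] := set_0Vmem F.
  by exists xpredT => x y; rewrite F0 inE.
have [z zF zmax] := arg_maxnP h z0F.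
have {}zF : z \in F by [].
have sF x : x \in F :\ z -> x \in F by case/setD1P.
have [|||c cP] := IH (F :\ z).
- by move: leFn; rewrite (cardsD1 z) zF.
- by move=> x y /sF xF /sF yF; apply: eh.
- by move=> x x' y /sF xF /sF xF' /sF yF; apply: eU.
pose d := if [pick x in F | e z x] is Some x then ~~ c x else true.
exists (fun x => if x == z then d else c x) => x y xF yF eyx.
have hxy := eh _ _ xF yF eyx; have := zmax _ yF; rewrite /= => yz.
have xz : x != z by apply: contraTneq hxy => ->; rewrite -leqNgt.
rewrite (negPf xz); case: (eqVneq y z) => [yE|yz']; last first.
  by apply: cP; rewrite // in_setD1 ?xz ?yz' ?xF ?yF.
rewrite /d; case: pickP => [x' /andP[xF' ezx']|/(_ x)]; last first.
  by rewrite xF -yE eyx.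
have -> : x' = x by apply: (eU _ _ y) => //; rewrite yE.
by case: (c x).
Qed.

Lemma half_color (F : {set T}) (c : T -> bool) :
  exists b, #|F| <= 2 * #|[set x in F | c x == b]|.
Proof.
have := cardsID [set x | c x] F.
have -> : F :&: [set x | c x] = [set x in F | c x == true].
  by apply/setP => x; rewrite !inE eqb_id.
have -> : F :\: [set x | c x] = [set x in F | c x == false].
  by apply/setP => x; rewrite !inE eqbF_neg andbC.
move=> E; case: (leqP #|[set x in F | c x == true]|
  #|[set x in F | c x == false]|) => ?; [exists false | exists true]; lia.
Qed.

Lemma fconnectP (f : T -> T) x y :
  reflect (exists i, y = iter i f x) (fconnect f x y).
Proof.
apply: (iffP idP) => [xy|[i ->]]; last exact: fconnect_iter.
by exists (findex f x y); rewrite iter_findex.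
Qed.

Lemma fconnect_step (f : T -> T) x y :
  fconnect f x y -> x != y -> fconnect f (f x) y.
Proof.
case/fconnectP => -[/= ->|i ->]; first by rewrite eqxx.
by rewrite iterSr fconnect_iter.
Qed.

Lemma fconnect_comparable (f : T -> T) z x y :
  fconnect f z x -> fconnect f z y -> fconnect f x y || fconnect f y x.
Proof.
case/fconnectP => i -> /fconnectP[j ->]; case: (leqP i j) => [le_ij | /ltnW le_ji].
  by rewrite -(subnK le_ij) iterD fconnect_iter.
by rewrite -(subnK le_ji) iterD fconnect_iter orbT.
Qed.

End FiniteSets.

(** * Out-trees described by parent functions *)

Section ParentFunctions.

Variable D : digraph.
Implicit Types (S : {set D}) (q : D -> D) (r : D) (g : D -> nat).

(* [g] is a rank that excludes cycles; [q] fixes the root. *)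
Definition ptree S q r g :=
  [/\ r \in S, q r = r & forall x, x \in S -> x != r ->
    [/\ q x \in S, arc (q x) x & g (q x) < g x]].

Definition pleaves S q r : {set D} := S :\: q @: (S :\ r).

Lemma ptree_anc S q r g x y : ptree S q r g -> x \in S -> fconnect q x y ->
  y \in S /\ g y <= g x.
Proof.
move=> [rS qr St] xS /fconnectP[i ->]; elim: i => //= i [IS IH].
case: (eqVneq (iter i q x) r) => [E|/(St _ IS)[? _ ?]].
  by rewrite E qr; rewrite E in IH.
split=> //; lia.
Qed.

Lemma ptree_root S q r g x : ptree S q r g -> x \in S -> fconnect q x r.
Proof.
move=> [rS qr St]; move: {2}(g x) (leqnn (g x)) => n.
elim: n x => [|n IH] x gx xS; case: (eqVneq x r) => [->//|/(St _ xS)[qxS _ lt]].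
  by move: gx; rewrite leqn0 => /eqP E; rewrite E in lt.
by apply: connect_trans (fconnect1 _ _) (IH _ _ qxS); lia.
Qed.

Lemma ptree_leaf_below S q r g x : ptree S q r g -> x \in S ->
  exists2 l, l \in pleaves S q r & fconnect q l x.
Proof.
move=> St xS.
have Px : [pred y | (y \in S) && fconnect q y x] x by rewrite /= xS connect0.
have [l /= /andP[lS lx] lmax] := arg_maxnP g Px.
exists l => //; rewrite inE lS andbT; apply/imsetP => -[z /setD1P[zr zS] lE].
have [_ _ lt] : [/\ q z \in S, arc (q z) z & g (q z) < g z].
  by case: St => _ _; apply.
have /= := lmax z; rewrite zS (connect_trans (fconnect1 _ _)) -?lE // => /(_ isT).
by move: lt; rewrite -lE; lia.
Qed.

Lemma ptree_out_tree S q r g : ptree S q r g ->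
  exists2 H : subdigraph D, out_tree H & leaves H = pleaves S q r.
Proof.
move=> St; have [rS qr Sq] := St.
pose H : subdigraph D := (S, [set a | (a.2 \in S :\ r) && (a.1 == q a.2)]).
have HE x y : ((x, y) \in H.2) = (y \in S :\ r) && (x == q y) by rewrite inE.
have Hg x y : (x, y) \in H.2 -> g x < g y.
  by rewrite HE => /andP[/setD1P[yr yS] /eqP->]; case: (Sq y yS yr).
have adjS : symmetric (adjacent H) by move=> x y; apply: orbC.
exists H; last first.
  apply/setP => x; rewrite in_setD inE andbC; congr (_ && _).
  apply/eqP/idP => [out0|/imsetP xq].
    apply/imsetP => -[y yS xE]; move/eqP: out0; rewrite cards_eq0 => /eqP/setP/(_ y).
    by rewrite [in LHS]inE HE yS xE eqxx inE.
  apply/eqP; rewrite cards_eq0; apply/eqP/setP => y; rewrite !in_set0 in_set HE.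
  by apply/negP => /andP[yS /eqP xE]; case: xq; exists y.
apply/andP; split; last first.
  apply/cards1P; exists r; apply/setP => x; rewrite !inE cards_eq0.
  apply/idP/eqP => [/andP[xS /eqP/setP/(_ (q x))]|->].
    by rewrite !inE xS eqxx !andbT => /negbFE/eqP.
  by rewrite rS; apply/eqP/setP => y; rewrite !inE eqxx.
apply/and4P; split.
- apply/forall_inP => -[x y]; rewrite HE /= => /andP[/setD1P[yr yS] /eqP->].
  by have [-> ->] := Sq y yS yr; rewrite yS.
- apply/forallP => x; apply/forallP => y; apply/implyP => /Hg xy.
  by apply/negP => /Hg; lia.
- have toroot x : x \in S -> connect (adjacent H) x r.
    move=> xS; have [i] := fconnectP _ _ _ (ptree_root St xS).
    elim: i x xS => [|i IH] x xS; first by move=> ->.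
    case: (eqVneq x r) => [->//|xr]; have [qS _ _] := Sq x xS xr.
    rewrite iterSr => /(IH _ qS); apply: connect_trans; apply: connect1.
    by apply/orP; right; rewrite HE eqxx in_setD1 xr xS.
  apply/forall_inP => x xS; apply/forall_inP => y yS.
  apply: connect_trans (toroot x xS) _.
  by rewrite (sym_connect_sym adjS) ?toroot.
apply/acyclicP => s /andP[cs us]; rewrite leqNgt; apply/negP => s3.
have [x0 x0s] : exists x, x \in s.
  by case: s s3 {cs us} => // x ? _; exists x; rewrite mem_head.
have [x xs xmax] := arg_maxnP g x0s.
have {}xs : x \in s by [].
case: (rot_to xs) => i s' sE.
have us' : uniq (x :: s') by rewrite -sE rot_uniq.
have cs' : cycle (adjacent H) (x :: s') by rewrite -sE rot_cycle.
have s3' : 2 < size (x :: s') by rewrite -sE size_rot.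
have smax y : y \in x :: s' -> g y <= g x.
  by rewrite -sE mem_rot => /xmax.
(* A vertex of maximal rank on a cycle would have two distinct parents. *)
have par y : y \in x :: s' -> adjacent H x y -> y = q x.
  move=> /smax yx /orP[/Hg|]; first by lia.
  by rewrite HE => /andP[_ /eqP].
case: s' {sE smax} us' cs' s3' par => // y s' us' cs' s3' par.
case/lastP: s' us' cs' s3' par => // s' z us' cs' _ par.
have zin : z \in x :: y :: rcons s' z by rewrite !inE mem_rcons inE eqxx !orbT.
move: cs'; rewrite /= rcons_path last_rcons => /and3P[xy _ zx].
have yE : y = q x by apply: par xy; rewrite !inE eqxx orbT.
have zE : z = q x by apply: par zin _; rewrite adjS.
by move: us'; rewrite /= mem_rcons inE yE zE eqxx andbF.
Qed.

Lemma pleaves_le S q r g : ptree S q r g -> #|pleaves S q r| <= max_leaves D.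
Proof.
by case/ptree_out_tree => H Ht <-; apply: leq_bigmax_cond.
Qed.

Lemma out_branching_ptree (H : subdigraph D) : out_branching H ->
  exists q r g, ptree [set: D] q r g.
Proof.
case/andP => /andP[/and4P[/forall_inP sub orH _ /acyclicP ac]].
move=> /cards1P[r rE] /eqP HT.
pose e : rel D := [rel x y | (x, y) \in H.2].
have eacyc x y : e x y -> ~~ connect e y x.
  move=> exy; apply/negP => /connectP[s0 es0 xE].
  case/shortenP: es0 xE => s es us _ xE.
  have cs : cycle e (y :: s) by rewrite /= rcons_path es -xE.
  have : ucycle (adjacent H) (y :: s).
    apply/andP; split=> //; by apply: sub_path cs => u v uv; apply/orP; left.
  (* With at most two vertices left, the cycle is a loop or a directed 2-cycle. *)
  move=> /ac; case: s {us cs} es xE => [|z [|//]] /= es xE _.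
    move: (sub _ exy); rewrite xE /= => /and3P[_ _].
    by rewrite arc_irrefl.
  move: es; rewrite andbT -xE => yx.
  by have /forallP/(_ x)/forallP/(_ y) := orH; rewrite [_ \in _]exy [_ \in _]yx.
(* The root has no in-arc, so the default makes it a fixed point. *)
pose q x := odflt x [pick y | e y x].
have qr : q r = r.
  rewrite /q; case: pickP => //= y eyr.
  have : r \in root_set H by rewrite rE inE.
  rewrite inE => /andP[_]; rewrite cards_eq0 => /eqP/setP/(_ y).
  by rewrite !inE [_ \in _]eyr.
(* The rank counts the vertices that reach [x]; by acyclicity [x] does not reach its parent, which
   therefore has fewer. *)
exists q, r, (fun x => #|[set y | connect e y x]|); split=> // x _ xr.
have ex : e (q x) x.
  rewrite /q; case: pickP => //= no.
  have : x \in root_set H.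
    rewrite inE HT inE /= cards_eq0; apply/eqP/setP => y.
    by rewrite !inE; apply: no.
  by rewrite rE inE (negPf xr).
split; rewrite ?inE //; first by case/and3P: (sub _ ex).
apply/proper_card/properP; split.
  by apply/subsetP => y; rewrite !inE => /connect_trans; apply; apply: connect1.
by exists x; rewrite !inE ?connect0 // eacyc.
Qed.

End ParentFunctions.

(** * Ancestry in a fixed out-branching *)

Section SpanningTree.

Variables (D : digraph) (p : D -> D) (r : D) (h : D -> nat).
Hypothesis spanT : ptree [set: D] p r h.

Local Notation k := (max_leaves D).

Let p_root : p r = r.
Proof. by case: spanT. Qed.

Let parentP x : x != r -> arc (p x) x /\ h (p x) < h x.
Proof. by case: spanT => _ _ pT /(pT x (in_setT x))[]. Qed.

Let anc_le x y : fconnect p y x -> h x <= h y.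
Proof. by case/(ptree_anc spanT (in_setT y)). Qed.

Let anc_root x : fconnect p r x -> x = r.
Proof. by case/fconnectP => i ->; apply: iter_fix. Qed.

Let anc_lt x y : fconnect p y x -> y != x -> h x < h y.
Proof.
move=> yx nyx; have yr : y != r.
  by apply: contraNneq nyx => yE; move: yx; rewrite yE => /anc_root->.
by apply: leq_ltn_trans (anc_le (fconnect_step yx nyx)) _; case: (parentP yr).
Qed.

Let child_toward x y : fconnect p y x -> y != x ->
  exists c, [/\ p c = x, c != x & fconnect p y c].
Proof.
case/fconnectP => i; elim: i y => [|i IH] y; first by move=> ->; rewrite eqxx.
rewrite iterSr => xE nyx; case: (eqVneq (p y) x) => [pyx|npyx].
  by exists y; rewrite pyx nyx connect0.
have [c [pc cx yc]] := IH _ xE npyx; exists c; split=> //.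
exact: connect_trans (fconnect1 _ _) yc.
Qed.

Definition anc l : {set D} := [set x | fconnect p l x].

Let anc_par_inj l x y : x \in anc l -> y \in anc l -> x != r -> y != r ->
  p x = p y -> x = y.
Proof.
rewrite !inE => lx ly xr yr pxy; apply/eqP; apply/negPn/negP => nxy.
have [_ hx] := parentP xr; have [_ hy] := parentP yr.
case/orP: (fconnect_comparable lx ly) => [xy|yx].
  by have := anc_le (fconnect_step xy nxy); rewrite pxy; lia.
rewrite eq_sym in nxy.
by have := anc_le (fconnect_step yx nxy); rewrite -pxy; lia.
Qed.

(** * The forest of back arcs *)

(** There are no loops, so [w] differs from [x], and [p w != x] then puts it at distance at least 2
    below [x]. *)
Definition back x : pred D := [pred w | [&& arc w x, fconnect p w x & p w != x]].

Definition backless : {set D} := [set x | [forall w, ~~ back x w]].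

(** The default makes backless vertices fixed points, hence the roots of the forest. *)
Definition beta x := odflt x [pick w | back x w].

Let beta_backless x : x \in backless -> beta x = x.
Proof.
rewrite inE => /forallP no; rewrite /beta; case: pickP => //= w.
by rewrite (negPf (no w)).
Qed.

Let betaP x : x \notin backless -> back x (beta x).
Proof.
rewrite inE negb_forall => /existsP[w]; rewrite negbK => xw.
by rewrite /beta; case: pickP => //= /(_ w); rewrite xw.
Qed.

(** The distance from [x] to [beta x] leaves room for a child of [x] strictly between them. *)
Let beta_child x : x \notin backless ->
  exists c, [/\ p c = x, c != r, h x < h c & h c < h (beta x)].
Proof.
case/betaP/and3P; set w := beta x => wx xw pwx.
have nwx : w != x by apply: contraTneq wx => ->; rewrite arc_irrefl.
have wr : w != r by apply: contraNneq nwx => wE; move: xw; rewrite wE => /anc_root->.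
have [c [pc cx wc]] := child_toward (fconnect_step xw nwx) pwx.
have [_ hw] := parentP wr; exists c; split=> //.
- by apply: contraNneq cx => cE; rewrite -pc cE p_root.
- by apply: anc_lt => //; rewrite -pc fconnect1.
by apply: leq_ltn_trans (anc_le wc) hw.
Qed.

Let beta_lt x : x \notin backless -> h x < h (beta x).
Proof. by case/beta_child => c [_ _ /ltn_trans]; apply. Qed.

Let beta_le x y : fconnect beta x y -> h x <= h y.
Proof.
case/fconnectP => i ->; elim: i => //= i IH; apply: leq_trans IH _.
have [/beta_backless->//|/beta_lt/ltnW//] := boolP (iter i beta x \in backless).
Qed.

Let beta_top x : exists2 z, z \in backless & fconnect beta x z.
Proof.
have [z xz zmax] := @arg_maxnP _ x (fconnect beta x) h (connect0 _ _).
exists z => //; apply/negPn/negP => /beta_lt.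
have /= := zmax (beta z) (connect_trans xz (fconnect1 _ _)); lia.
Qed.

Let beta_fix z y : z \in backless -> fconnect beta z y -> y = z.
Proof. by move=> zX /fconnectP[i ->]; apply/iter_fix/beta_backless. Qed.

(** Moving to a parent under [beta] raises [h], so [N - h] serves as the rank of such trees. *)
Let N := \max_x h x.
Let hN x : h x <= N.
Proof. exact: leq_bigmax. Qed.

(** The child [c y] has [h] strictly between the values at the consecutive orbit points [y] and
    [beta y], so it lies off the orbit and is a leaf once attached. Different [y] have different
    [c y]; only the root [z] gets none, whence the [+ 1]. *)
Lemma card_beta_orbit x : #|[set z | fconnect beta x z]| <= k.+1.
Proof.
set O := [set z | _]; have [z zX xz] := beta_top x.
have zO : z \in O by rewrite inE.
have OX y : y \in O -> y != z -> y \notin backless.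
  rewrite inE => xy; apply: contraNN => yX; apply/eqP.
  by case/orP: (fconnect_comparable xz xy) => /beta_fix ->.
have betaO y : y \in O -> beta y \in O.
  by rewrite !inE => xy; apply: connect_trans xy (fconnect1 _ _).
pose c y := odflt y [pick c | [&& p c == y, c != r, h y < h c & h c < h (beta y)]].
have cP y : y \in O :\ z ->
    [/\ p (c y) = y, c y != r, h y < h (c y) & h (c y) < h (beta y)].
  case/setD1P => yz /OX/(_ yz)/beta_child[d [d1 d2 d3 d4]].
  rewrite /c; case: pickP => [d' /and4P[/eqP-> -> -> ->]//|/(_ d)].
  by rewrite d1 eqxx d2 d3 d4.
have cO y : y \in O :\ z -> c y \notin O.
  move=> yOz; have [_ _ yc cb] := cP y yOz; case/setD1P: yOz => yz yO.
  apply/negP; rewrite !inE in yO * => xc.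
  case/orP: (fconnect_comparable yO xc) => [yc'|/beta_le]; last by lia.
  have nyc : y != c y by apply: contraTneq yc => <-; rewrite ltnn.
  by have := beta_le (fconnect_step yc' nyc); lia.
pose S := O :|: c @: (O :\ z).
pose q y := if y \in O then beta y else p y.
(* Attached children rank above the whole orbit. *)
pose g y := if y \in O then N - h y else N.+1.
have St : ptree S q z g.
  split; first by rewrite inE zO.
    by rewrite /q zO beta_backless.
  move=> y /setUP[yO yz|/imsetP[u uO ->] _]; rewrite /q /g.
    rewrite yO betaO // inE betaO //; have yX := OX y yO yz.
    case/and3P: (betaP yX) => ? _ _; split=> //.
    by have := beta_lt yX; have := hN (beta y); lia.
  rewrite (negPf (cO u uO)); have [pc cr _ _] := cP u uO.
  have [ac _] := parentP cr; rewrite pc in ac *.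
  by case/setD1P: uO => _ uO; rewrite inE uO; split=> //; lia.
have cI : {in O :\ z &, injective c}.
  by move=> u v /cP[pu _ _ _] /cP[pv _ _ _] cuv; rewrite -pu cuv pv.
rewrite (cardsD1 z) zO -(card_in_imset cI) ltnS.
apply: leq_trans (pleaves_le St); apply: subset_leq_card; apply/subsetP => y yc.
rewrite !inE yc orbT andbT; case/imsetP: yc => u uO ->.
apply: contra (cO u uO) => /imsetP[v /setD1P[_ /setUP[vO|/imsetP[v' v'O ->]]] ->].
  by rewrite /q vO betaO.
rewrite /q (negPf (cO v' v'O)); have [-> _ _ _] := cP v' v'O.
by case/setD1P: v'O.
Qed.

(** Two covers: [D] by the trees of [beta], and each tree by the orbits of its leaves. *)
Lemma card_le_backless : #|D| <= #|backless| * (k * k.+1).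
Proof.
rewrite -cardsT.
apply: (card_cover_le (A := fun z => [set x | fconnect beta x z])) => [x _|z zX].
  by have [z zX xz] := beta_top x; exists z => //; rewrite inE.
set S := [set x | _].
have St : ptree S beta z (fun x => N - h x).
  split; first by rewrite inE connect0.
    exact: beta_backless.
  move=> x; rewrite !inE => xz nxz; split; first exact: fconnect_step.
    suff /betaP/and3P[] : x \notin backless by [].
    by apply: contra nxz => xX; rewrite (beta_fix xX xz).
  suff /beta_lt : x \notin backless by have := hN (beta x); lia.
  by apply: contra nxz => xX; rewrite (beta_fix xX xz).
apply: leq_trans (leq_mul (pleaves_le St) (leqnn _)).
apply: (card_cover_le (A := fun l => [set x | fconnect beta l x])) => [x xS|l _].
  by have [l lL lx] := ptree_leaf_below St xS; exists l => //; rewrite inE.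
exact: card_beta_orbit.
Qed.

(** * Backless vertices on a root path *)

(** The path together with these children is an out-tree in which all of them are leaves. *)
Lemma card_off_path l :
  #|[set y | (y \notin anc l) && (p y \in anc l)]| <= k.
Proof.
set Q := [set y | _].
have rl : r \in anc l by rewrite inE (ptree_root spanT) ?inE.
have St : ptree (anc l :|: Q) p r h.
  split; rewrite ?p_root //; first by rewrite inE rl.
  move=> y yS yr; have [ay hy] := parentP yr; split=> //.
  rewrite inE; apply/orP; left; case/setUP: yS; last by rewrite inE => /andP[].
  by rewrite !inE => ly; apply: connect_trans ly (fconnect1 _ _).
apply: leq_trans (pleaves_le St); apply: subset_leq_card; apply/subsetP => y yQ.
rewrite in_setD in_setU yQ orbT andbT; move: yQ; rewrite inE => /andP[yl _].
apply: contra yl => /imsetP[v /setD1P[_ /setUP[]]]; last first.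
  by rewrite inE => /andP[_ ?] ->.
by rewrite !inE => lv ->; apply: connect_trans lv (fconnect1 _ _).
Qed.

(* Rerouting the path to [l] through [w] on one colour class keeps an
   out-branching, ranked by the place where a vertex branches off the path; each
   rerouted vertex turns its old parent into a leaf. *)
Lemma card_reroutable l (w : D -> D) (F : {set D}) :
  F \subset anc l :\ r ->
  (forall x, x \in F -> [/\ arc (w x) x, w x != p x & ~~ fconnect p (w x) x]) ->
  (forall x y, x \in F -> p y = p x -> y \in anc l) ->
  #|F| <= 2 * k.
Proof.
move=> /subsetP sF wP onpath.
have Fl x : x \in F -> x \in anc l by case/sF/setD1P.
have Fr x : x \in F -> x != r by case/sF/setD1P.
have comp x y : x \in anc l -> y \in anc l -> ~~ fconnect p y x -> h y < h x.
  rewrite !inE => lx ly nyx; case/orP: (fconnect_comparable lx ly) => [xy|yx].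
    by apply: anc_lt xy _; apply: contraNneq nyx => ->; rewrite connect0.
  by rewrite yx in nyx.
(* Rerouting [y] to the old parent of [x] would keep that parent from becoming a leaf, so [x] and
   [y] must get different colours. *)
have [||c cP] := @bicoloring D [rel y x | p x == w y] h F.
- move=> x y xF yF /= /eqP pxw; have [_ wp nwy] := wP y yF.
  apply: comp; rewrite ?Fl //; apply: contra nwy => xy; rewrite -pxw.
  apply: fconnect_step xy _; apply: contraNneq wp => xE.
  by rewrite -pxw xE.
- move=> x x' y xF xF' yF /= /eqP px /eqP px'.
  by apply: (anc_par_inj (Fl x xF) (Fl x' xF')); rewrite ?Fr // px px'.
have [b bP] := half_color F c; apply: leq_trans bP _; rewrite leq_mul2l /=.
set J := [set x in F | _]; have JF x : x \in J -> x \in F by rewrite inE => /andP[].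
pose q x := if x \in J then w x else p x.
pose m y := \max_(z | fconnect p y z && fconnect p l z) h z.
have hm y z : fconnect p y z -> fconnect p l z -> h z <= m y.
  move=> yz lz; rewrite /m.
  by apply: (@leq_bigmax_cond D (fun u => fconnect p y u && _ u) h z); rewrite yz lz.
(* The rank is lexicographic in [m] and [h], as [h] is at most [N]. A rerouted [x] lies on the path
   and [w x] branches off strictly above it, so [m] drops; an unchanged parent does not raise [m]
   and lowers [h]. *)
have St : ptree [set: D] q r (fun y => m y * N.+1 + h y).
  split; rewrite ?inE //.
    by rewrite /q; case: ifP => // /JF/Fr; rewrite eqxx.
  move=> x _ xr; rewrite /q; case: ifP => [/JF xF|_].
    have [awx _ nwx] := wP x xF; split; rewrite ?inE //.
    have mx : h x <= m x.
      by apply: hm; rewrite ?connect0 //; have := Fl x xF; rewrite inE.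
    have [_ hx] := parentP xr.
    have mw : m (w x) < h x.
      apply: (@leq_ltn_trans (h x).-1); last by lia.
      apply/bigmax_leqP => z /andP[wz lz].
      suff : h z < h x by lia.
      apply: (comp x z (Fl x xF)); first by rewrite inE.
      by apply: contra nwx => zx; apply: connect_trans wz zx.
    have lt_m : (m (w x)).+1 * N.+1 <= m x * N.+1.
      by rewrite leq_mul2r (leq_trans mw mx) orbT.
    by have := hN (w x); lia.
  have [apx hx] := parentP xr; split; rewrite ?inE //.
  suff : m (p x) * N.+1 <= m x * N.+1 by lia.
  rewrite leq_mul2r; apply/orP; right; apply/bigmax_leqP => z /andP[pxz lz].
  by apply: hm lz; apply: connect_trans (fconnect1 _ _) pxz.
have pI : {in J &, injective p}.
  move=> x y /JF xF /JF yF; apply: (anc_par_inj (Fl x xF) (Fl y yF)); exact: Fr.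
rewrite -(card_in_imset pI); apply: leq_trans (pleaves_le St).
apply: subset_leq_card; apply/subsetP => _ /imsetP[x xJ ->]; have xF := JF x xJ.
rewrite !inE andbT; apply/imsetP => -[z /setD1P[zr _]]; rewrite /q.
(* A remaining child [z] of [p x] is either rerouted there, against the colouring, or an old child;
   the latter is on the path, hence equals [x], which was rerouted. *)
case: ifP => [zJ pxw|zJ pxz].
  have := cP x z xF (JF z zJ); rewrite /= pxw eqxx => /(_ isT).
  by move: xJ zJ; rewrite !inE => /andP[_ /eqP->] /andP[_ /eqP->]; rewrite eqxx.
have zl : z \in anc l by apply: (onpath x) => //.
have zx : z = x by apply: (anc_par_inj zl (Fl x xF)) => //; exact: Fr.
by rewrite zx xJ in zJ.
Qed.

(** Common consequence of both degree conditions: in-degree 3 allows avoiding two vertices, and in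
    an oriented graph an out-neighbour [z] of [x] is never an in-neighbour, so in-degree 2 is
    enough. *)
Hypothesis extra_in_neighbour : forall x y z : D, z = y \/ arc x z ->
  exists w, [/\ arc w x, w != y & w != z].

(** Discarded are the root, at most [k] parents of off-path children, and at most [k] path vertices
    whose parent is one of those. What remains is reroutable and contributes at most [2 * k]. *)
Lemma card_backless_path l : #|backless :&: anc l| <= 4 * k + 1.
Proof.
set Q := [set y | (y \notin anc l) && (p y \in anc l)].
have QP x y : x \in anc l -> x \notin p @: Q -> p y = x -> y \in anc l.
  move=> xl xQ pyx; apply/negPn/negP => yl; case/negP: xQ; apply/imsetP.
  by exists y; rewrite // inE yl pyx.
pose B := [set x in anc l :\ r | p x \in p @: Q].
pose F := (backless :&: anc l) :\: (r |: (p @: Q :|: B)).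
have pQ : #|p @: Q| <= k by apply: leq_trans (leq_imset_card _ _) (card_off_path l).
have cB : #|B| <= k.
  have pI : {in B &, injective p}.
    move=> x y /setIdP[/setD1P[xr xl] _] /setIdP[/setD1P[yr yl] _].
    exact: anc_par_inj xl yl xr yr.
  rewrite -(card_in_imset pI); apply: leq_trans pQ.
  by apply/subset_leq_card/subsetP => _ /imsetP[x /setIdP[_ pxQ] ->].
have FP x : x \in F ->
  [/\ x \in backless, x \in anc l, x != r, x \notin p @: Q & p x \notin p @: Q].
  rewrite in_setD in_setI in_setU1 in_setU 2!negb_or.
  move=> /andP[/and3P[xr xQ xB] /andP[xX xl]].
  by split=> //; apply: contra xB => pxQ; rewrite inE in_setD1 xr xl.
pose P x := [pred w | [&& arc w x, w != p x & ~~ fconnect p w x]].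
pose w x := odflt x [pick w | P x w].
have cF : #|F| <= 2 * k.
  apply: (@card_reroutable l w).
  - by apply/subsetP => x /FP[_ xl xr _ _]; rewrite in_setD1 xr.
  - move=> x /FP[xX xl xr xQ _].
    suff [v Pv] : exists v, P x v.
      by rewrite /w; case: pickP => [? /and3P[]//|/(_ v)]; rewrite Pv.
    (* [z] is the only child of [x], or its parent if there is no child. As [x] is backless, an
       in-neighbour below [x] could only be that child, so avoiding [z] suffices. *)
    pose z := odflt (p x) [pick z | (p z == x) && (z != r)].
    have zE : z = p x \/ arc x z.
      rewrite /z; case: pickP => [y /andP[/eqP pyx /parentP[]]|_]; last by left.
      by rewrite pyx; right.
    have [v [vx vp vz]] := extra_in_neighbour zE.
    exists v; rewrite /= vx vp /=; apply/negP => vxc.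
    have nvx : v != x by apply: contraTneq vx => ->; rewrite arc_irrefl.
    have vr : v != r.
      by apply: contraNneq nvx => vE; move: vxc; rewrite vE => /anc_root->.
    have pvx : p v = x.
      apply/eqP; apply: contraLR xX => npv; rewrite inE negb_forall.
      by apply/existsP; exists v; rewrite negbK; apply/and3P.
    case/eqP: vz; rewrite /z; case: pickP => [y /andP[/eqP pyx yr]|/(_ v)].
      by apply: (anc_par_inj (QP x v xl xQ pvx) (QP x y xl xQ pyx)); rewrite ?pyx.
    by rewrite pvx eqxx vr.
  - move=> x y /FP[_ xl xr _ pxQ]; apply: QP => //.
    by move: xl; rewrite !inE => lx; apply: connect_trans lx (fconnect1 _ _).
have : #|backless :&: anc l| <= #|F| + #|r |: (p @: Q :|: B)|.
  rewrite addnC -(cardsID (r |: (p @: Q :|: B)) (backless :&: anc l)) leq_add2r.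
  by rewrite subset_leq_card // subsetIr.
rewrite cardsU1; have [+ _] := leq_card_setU (p @: Q) B.
by case: (_ \notin _) => /=; lia.
Qed.

Lemma order_bound : #|D| <= 2 * k.+1 ^ 5.
Proof.
have leX : #|backless| <= k * (4 * k + 1).
  apply: leq_trans (leq_mul (pleaves_le spanT) (leqnn _)).
  apply: (card_cover_le (A := fun l => backless :&: anc l)) => [x xX|l _].
    have [l lL lx] := ptree_leaf_below spanT (in_setT x).
    by exists l; rewrite // in_setI xX inE.
  exact: card_backless_path.
apply: leq_trans card_le_backless _; apply: leq_trans (leq_mul leX (leqnn _)) _.
(* The product [k (4k + 1) k (k + 1)] is dominated coefficientwise by [2 (k + 1)^5]. *)
by rewrite !expnS expn0; nia.
Qed.

End SpanningTree.

(** * From the degree conditions to the fifth root *)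

Lemma order_bound_of_L (D : digraph) : family_L D -> 0 < max_leaves_spanning D ->
  (forall x y z : D, z = y \/ arc x z -> exists w, [/\ arc w x, w != y & w != z]) ->
  #|D| <= 2 * (max_leaves_spanning D).+1 ^ 5.
Proof.
case=> [->//|LE] ls_gt0 deg.
have [H Hb|no] := pickP (@out_branching D).
  have [p [r [h spanT]]] := out_branching_ptree Hb.
  by rewrite LE; apply: order_bound spanT deg.
by move: ls_gt0; rewrite /max_leaves_spanning big_pred0.
Qed.

Lemma indegree_avoid (D : digraph) (x : D) (A : {set D}) :
  #|A| < indegree x -> exists2 w, arc w x & w \notin A.
Proof.
move=> ltA; have : ~~ ([set y | arc y x] \subset A).
  by apply: contraL ltA => /subset_leq_card; rewrite -leqNgt.
by case/subsetPn => w; rewrite inE; exists w.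
Qed.

Lemma root5_bound (R : realType) (n k : nat) : n <= 2 * k.+1 ^ 5 ->
  ((n%:R / 2%:R) `^ (5%:R)^-1 - 1 <= k%:R :> R)%R.
Proof.
move=> le_n; rewrite lerBlDr natr1.
have -> : (k.+1%:R = ((k.+1%:R : R) ^+ 5) `^ (5%:R)^-1)%R.
  by rewrite -powR_mulrn // -powRrM mulfV ?powRr1 // pnatr_eq0.
apply: ge0_ler_powR; rewrite ?nnegrE ?invr_ge0 ?divr_ge0 ?exprn_ge0 //.
by rewrite ler_pdivrMr ?ltr0n // -natrX -natrM ler_nat mulnC.
Qed.

Local Open Scope ring_scope.

Theorem theorem3p3 (R : realType) (D : digraph) (n : nat)
    (order_D : #|D| = n)
    (D_in_L : family_L D)
    (ls_gt0 : (0 < max_leaves_spanning D)%N) :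
  (oriented D -> min_indegree_ge D 2 ->
     ((n%:R / 2%:R) `^ (5%:R)^-1 - 1 <= (max_leaves_spanning D)%:R :> R))
  /\
  (min_indegree_ge D 3 ->
     ((n%:R / 2%:R) `^ (5%:R)^-1 - 1 <= (max_leaves_spanning D)%:R :> R)).
Proof.
split=> [orD deg|deg]; apply: root5_bound; rewrite -order_D;
  apply: order_bound_of_L => // x y z yz.
  have [|w wx] := @indegree_avoid D x [set y]; first by rewrite cards1; apply: deg.
  rewrite inE => wy; exists w; split=> //; case: yz => [->//|xz].
  by apply: contraTneq wx => ->; apply: orD.
have [|w wx] := @indegree_avoid D x [set y; z].
  by apply: leq_trans (deg x); rewrite cards2; case: (y != z).
by rewrite !inE negb_or => /andP[wy wz]; exists w.
Qed.
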